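(* Let $G$ be a graph, $i\in V(G)$, and $k\ge 0$ an integer. Then $(G,i)$ allows the nullity pair $(k,k)$ with the SNIP if and only if $(G,i)$ allows the nullity pair $(k+1,k)$ with the SNIP.
   Context: All matrices are real. For a simple graph $G$ on $[n]$, $\mathcal{S}(G)$ is the set of real symmetric $n\times n$ matrices whose off-diagonal $(j,k)$ entry is nonzero iff $\{j,k\}\in E(G)$ (diagonal free). $A(i)$ is $A$ with row and column $i$ deleted. $A$ has the $i$-SNIP if $X=O$ is the only real symmetric $X$ with $A\circ X=O$, $I\circ X=O$ and $(AX)(i,:]=O$ ($AX$ with row $i$ deleted). $(G,i)$ allows $(k,\ell)$ with the SNIP if some $A\in\mathcal{S}(G)$ with the $i$-SNIP has $(\operatorname{null}(A),\operatorname{null}(A(i)))=(k,\ell)$. *)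

(* Defs.v *)
From HB Require Import structures.
From mathcomp Require Import all_boot all_order all_algebra.
From mathcomp Require Import reals.

Set Implicit Arguments.
Unset Strict Implicit.
Unset Printing Implicit Defensive.

Import GRing.Theory.
Local Open Scope ring_scope.

Record sgraph (n : nat) := SGraph {
  edge :> rel 'I_n;
  edge_sym : symmetric edge;
  edge_irrefl : irreflexive edge
}.

Definition hadamard (R : realType) (m n : nat) (A B : 'M[R]_(m, n)) :
    'M[R]_(m, n) :=
  \matrix_(j, k) (A j k * B j k).

(* The columns of cokermx A span the null space {v | A *m v = 0}. *)
Definition nullity (R : realType) (n : nat) (A : 'M[R]_n) : nat :=
  \rank (cokermx A).

Definition del_vertex (R : realType) (n : nat) (i : 'I_n) (A : 'M[R]_n) :
    'M[R]_n.-1 :=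
  row' i (col' i A).

Definition graph_mx (R : realType) (n : nat) (G : sgraph n) (A : 'M[R]_n) :
    Prop :=
  A^T = A /\ (forall j k : 'I_n, j != k -> (A j k != 0) = G j k).

Definition SNIP (R : realType) (n : nat) (i : 'I_n) (A : 'M[R]_n) : Prop :=
  forall X : 'M[R]_n,
    X^T = X -> hadamard A X = 0 -> hadamard 1%:M X = 0 ->
    row' i (A *m X) = 0 -> X = 0.

Definition allows_with_SNIP (R : realType) (n : nat) (G : sgraph n) (i : 'I_n)
    (k l : nat) : Prop :=
  exists A : 'M[R]_n,
    [/\ graph_mx G A, SNIP i A & (nullity A, nullity (del_vertex i A)) = (k, l)].

(* Main.v *)
(* The diagonal entry a_ii enters neither the pattern of G, nor A(i), nor the
   i-SNIP.  The difference null A - null A(i) is -1 unless the i-th row of A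
   without a_ii is a combination x of the rows of A(i).  In that case it is 1
   when a_ii = x A(i) x^T, and 0 for every other value of a_ii. *)
Require Import Defs.
From HB Require Import structures.
From mathcomp Require Import all_boot all_order all_algebra.
From mathcomp Require Import reals.
From mathcomp Require Import zify.

Set Implicit Arguments.
Unset Strict Implicit.
Unset Printing Implicit Defensive.

Import GRing.Theory.
Local Open Scope ring_scope.

Lemma mxrank_adds_row (F : fieldType) m n (u : 'rV[F]_n) (B : 'M_(m, n)) :
  \rank (u + B)%MS = (\rank B + ~~ (u <= B)%MS)%N.
Proof.
case: (boolP (u <= B)%MS) => uB /=.
  by rewrite addn0 (addsmx_idPr uB).
apply/eqP; rewrite eqn_leq; apply/andP; split.
  rewrite addnC (leq_trans (mxrank_adds_leqif u B)) // leq_add2r.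
  exact: rank_leq_row.
by rewrite addn1 rank_ltmx // ltmxE addsmxSr addsmx_sub negb_and uB.
Qed.

Lemma eqmx_row_row' (F : fieldType) m n (i : 'I_m) (A : 'M[F]_(m, n)) :
  (A :=: row i A + row' i A)%MS.
Proof.
apply/eqmxP/andP; split; last by rewrite addsmx_sub row_sub row'Esub rowsub_sub.
apply/row_subP => k; case: (unliftP i k) => [j ->|->]; last exact: addsmxSl.
have -> : row (lift i j) A = row j (row' i A) by apply/rowP => l; rewrite !mxE.
by rewrite (submx_trans (row_sub _ _)) ?addsmxSr.
Qed.

Lemma mxrank_row' (F : fieldType) m n (i : 'I_m) (A : 'M[F]_(m, n)) :
  \rank A = (\rank (row' i A) + ~~ (row i A <= row' i A)%MS)%N.
Proof. by rewrite {1}(eqmx_row_row' i A) mxrank_adds_row. Qed.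

(** By symmetry [row' i A] is the transpose of [col' i A], so the one-row rank formula applies a
    second time. *)
Lemma mxrank_row'_sym (F : fieldType) n (i : 'I_n) (A : 'M[F]_n) :
  A^T = A ->
  \rank (row' i A) = (\rank (row' i (col' i A))
    + ~~ (row i (col' i A) <= row' i (col' i A))%MS)%N.
Proof.
move=> symA; have tr_row'A : (row' i A)^T = col' i A by rewrite tr_row' symA.
by rewrite -mxrank_tr tr_row'A (mxrank_row' i).
Qed.

(** If the truncated row is outside the row space of the principal submatrix, restoring column [i]
    and then row [i] raises the rank by one each time, two in all. *)
Lemma row_col'_sub_rank (F : fieldType) n (i : 'I_n) (A : 'M[F]_n) :
  A^T = A -> (\rank A <= (\rank (row' i (col' i A))).+1)%N ->
  (row i (col' i A) <= row' i (col' i A))%MS.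
Proof.
move=> symA; rewrite (mxrank_row' i) (mxrank_row'_sym i symA) -addnA.
rewrite -[X in (_ <= X)%N]addn1 leq_add2l; apply: contraLR => nb.
(* Dropping column [i] turns a combination of full rows into one of truncated rows with the same
   coefficients. *)
have nu : ~~ (row i A <= row' i A)%MS.
  apply: contra nb => /submxP[x def_u]; apply/submxP; exists x.
  apply/rowP => j; have /rowP/(_ (lift i j)) := def_u.
  by rewrite !mxE => ->; apply: eq_bigr => l _; rewrite !mxE.
by rewrite nb nu.
Qed.

Definition set_diag (T : Type) n (i : 'I_n) (A : 'M[T]_n) (t : T) : 'M[T]_n :=
  \matrix_(j, k) if (j == i) && (k == i) then t else A j k.

Section SetDiag.
Variables (T : Type) (n : nat) (i : 'I_n) (A : 'M[T]_n) (t : T).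

Lemma set_diag_off j k : j != k -> set_diag i A t j k = A j k.
Proof.
by rewrite mxE; case: (j =P i) => //= ->; rewrite eq_sym => /negbTE ->.
Qed.

Lemma row'_set_diag : row' i (set_diag i A t) = row' i A.
Proof.
by apply/matrixP => j k; rewrite !mxE (negbTE (_ : _ != i)) // eq_sym neq_lift.
Qed.

Lemma col'_set_diag : col' i (set_diag i A t) = col' i A.
Proof.
apply/matrixP => j k; rewrite !mxE andbC.
by rewrite (negbTE (_ : lift i k != i)) // eq_sym neq_lift.
Qed.

Lemma tr_set_diag : A^T = A -> (set_diag i A t)^T = set_diag i A t.
Proof.
by move=> symA; apply/matrixP => j k; rewrite !mxE andbC -[in LHS]symA mxE.
Qed.

End SetDiag.

Lemma mxrank_set_diag (F : fieldType) n (i : 'I_n) (A : 'M[F]_n) :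
  A^T = A -> (row i (col' i A) <= row' i (col' i A))%MS ->
  exists s, forall t,
    \rank (set_diag i A t) = (\rank (row' i (col' i A)) + (t != s))%N.
Proof.
move=> symA bB; have /submxP[x def_b] := bB.
set B := row' i (col' i A) in bB def_b *.
have symB : B^T = B.
  by apply/matrixP => j k; rewrite !mxE -[in LHS]symA mxE.
have col_row' : col i (row' i A) = B *m x^T.
  rewrite -[B]symB -trmx_mul -def_b.
  by apply/colP => j; rewrite !mxE -[in LHS]symA mxE.
have row'_mul (y : 'rV_n.-1) j : (y *m row' i A) 0 (lift i j) = (y *m B) 0 j.
  by rewrite !mxE; apply: eq_bigr => l _; rewrite !mxE.
have diag_mul (y : 'rV_n.-1) : (y *m row' i A) 0 i = (y *m B *m x^T) 0 0.
  by rewrite -mulmxA -col_row' !mxE; apply: eq_bigr => l _; rewrite !mxE.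
(* This is the entry in column [i] of the combination [x] of the rows of [row' i A]. *)
exists ((x *m B *m x^T) 0 0) => t.
rewrite (mxrank_row' i) row'_set_diag (mxrank_row'_sym i symA) bB addn0.
congr (_ + ~~ _)%N; apply/submxP/eqP => [[y def_u] | def_t].
  (* The coefficients [y] may differ from [x] when [B] is singular, but by [diag_mul] the entry in
     column [i] depends only on [y *m B]. *)
  have def_yB : y *m B = x *m B.
    rewrite -def_b; apply/rowP => j; rewrite -row'_mul -def_u !mxE.
    by rewrite (negbTE (_ : lift i j != i)) ?andbF // eq_sym neq_lift.
  by rewrite -def_yB -diag_mul -def_u !mxE eqxx.
exists x; apply/rowP => k; rewrite mxE; case: (unliftP i k) => [j ->|->].
  rewrite set_diag_off ?neq_lift // row'_mul -def_b.
  by rewrite !mxE.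
by rewrite diag_mul mxE eqxx.
Qed.

Section SetDiagSNIP.
Variables (R : realType) (n : nat) (G : sgraph n) (i : 'I_n) (A : 'M[R]_n).

Lemma graph_mx_set_diag t : graph_mx G A -> graph_mx G (set_diag i A t).
Proof.
move=> [symA edgeA]; split; first exact: tr_set_diag.
by move=> j k neq_jk; rewrite set_diag_off // edgeA.
Qed.

(** In the Hadamard product the changed entry meets a zero diagonal entry of [X]; in [A *m X] it
    affects only the deleted row. *)
Lemma SNIP_set_diag t : SNIP i A -> SNIP i (set_diag i A t).
Proof.
move=> snipA X symX AX0 IX0 rowAX0; apply: snipA => //.
  apply/matrixP => j k; rewrite !mxE.
  have [<-|neq_jk] := eqVneq j k.
    by have /matrixP/(_ j j) := IX0; rewrite !mxE eqxx mul1r => ->; rewrite mulr0.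
  by have /matrixP/(_ j k) := AX0; rewrite mxE set_diag_off // mxE.
by move: rowAX0; rewrite !row'Esub -!mul_rowsub_mx -!row'Esub row'_set_diag.
Qed.

(** The inequality excludes the difference -1. It holds for both nullity pairs of the theorem, so
    this one statement serves both directions. *)
Lemma allows_set_diag :
  graph_mx G A -> SNIP i A ->
  (nullity (del_vertex i A) <= nullity A)%N ->
  allows_with_SNIP R G i (nullity (del_vertex i A)) (nullity (del_vertex i A)) /\
  allows_with_SNIP R G i (nullity (del_vertex i A)).+1
    (nullity (del_vertex i A)).
Proof.
move=> grA snipA; have [symA _] := grA.
have delA t : del_vertex i (set_diag i A t) = del_vertex i A.
  by rewrite /del_vertex col'_set_diag.
(* The nullities are truncated differences from [n] and [n.-1], so the arithmetic needs [n] positive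
   and the rank bounds. *)
have n_gt0 : (0 < n)%N by case: (n) i => [[]|].
have leB := rank_leq_col (del_vertex i A).
rewrite /nullity !mxrank_coker => le_null.
have [|s rank_t] := @mxrank_set_diag _ _ i A symA.
  apply: row_col'_sub_rank => //; rewrite -/(del_vertex i A).
  by have := rank_leq_col A; lia.
rewrite -/(del_vertex i A) in rank_t.
(* Any value other than [s] would do in place of [s + 1]: the extra rank offsets the extra
   dimension. *)
split; [exists (set_diag i A (s + 1)) | exists (set_diag i A s)];
  split; try exact: graph_mx_set_diag; try exact: SNIP_set_diag;
  rewrite delA /nullity !mxrank_coker rank_t; congr (_, _).
  by rewrite -subr_eq0 addrAC subrr add0r oner_eq0 /=; lia.
by rewrite eqxx /=; lia.
Qed.

End SetDiagSNIP.

Theorem corollary3p10 (R : realType) (n : nat) (G : sgraph n) (i : 'I_n)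
    (k : nat) :
  allows_with_SNIP R G i k k <-> allows_with_SNIP R G i k.+1 k.
Proof.
split=> -[A [grA snipA [nullA nullAi]]];
  by have [] := allows_set_diag grA snipA _; rewrite ?nullA nullAi.
Qed.
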